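(* Let $\Sigma$ be a two-letter alphabet, $\Gamma$ a finite alphabet with at least two letters, and let $w\in\Sigma^{\mathbb{N}}$ be an infinite word with $\mathrm{ACE}(w)\in\mathbb{R}$. If $w$ has uniform letter frequencies or $\mathrm{ACE}(w)\in\mathbb{N}$, then $\mathrm{ACE}_{\mathcal{I}}(w) = \mathrm{ACE}(w)$. Otherwise, $\mathrm{ACE}_{\mathcal{I}}(w) < \lceil\mathrm{ACE}(w)\rceil$.
   Context: An infinite word $w$ has uniform letter frequencies if for every letter $a$ occurring in $w$, $\liminf \frac{|f|_a}{|f|} = \limsup\frac{|f|_a}{|f|}$, where both are taken over factors $f$ of $w$ as $|f|\to\infty$ and $|f|_a$ is the number of occurrences of $a$ in $f$. $\mathrm{Fact}_n(w)$ is the set of length-$n$ factors of $w$. For a nonempty word $v$ and integer $p\ge0$, $v^{p/|v|}$ is the prefix of length $p$ of $vvv\cdots$. For a nonempty finite word $x$, $\mathrm{E}(x) = \sup\{ r \in \mathbb{Q} : x = v^r \text{ for some nonempty } v\}$. $\mathrm{ACE}(w) = \limsup_{n\to\infty}\sup\{\mathrm{E}(x) : x\in\mathrm{Fact}_n(w)\}$. $\mathcal{I}$ is the set of injective morphisms $\Sigma^*\to\Gamma^*$ and $\mathrm{ACE}_{\mathcal{I}}(w) = \sup\{\mathrm{ACE}(h(w)) : h\in\mathcal{I}\}$. *)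

(* Defs.v *)
From HB Require Import structures.
From mathcomp Require Import all_boot all_order all_algebra.
From mathcomp Require Import all_classical all_reals all_analysis.
Set Implicit Arguments. Unset Strict Implicit. Unset Printing Implicit Defensive.
Import Order.TTheory GRing.Theory Num.Theory.
Local Open Scope classical_set_scope.
Local Open Scope ring_scope.

Definition factor (A : Type) (w : nat -> A) (x : seq A) : Prop :=
  exists i, x = [seq w (i + k)%N | k <- iota 0 (size x)].

Definition Fact (A : Type) (w : nat -> A) (n : nat) : set (seq A) :=
  [set x | factor w x /\ size x = n].

(* v^{p/|v|} : the prefix of length p of vvv... (v nonempty) *)
Definition vpow (A : Type) (v : seq A) (p : nat) : seq A :=
  take p (flatten (nseq p v)).

Definition E (R : realType) (A : Type) (x : seq A) : R :=
  sup [set r : R | exists (v : seq A) (p : nat),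
         v <> [::] /\ x = vpow v p /\ r = p%:R / (size v)%:R].

Definition maxE (R : realType) (A : Type) (w : nat -> A) (n : nat) : R :=
  sup [set E R x | x in Fact w n].

Definition ACE (R : realType) (A : Type) (w : nat -> A) : \bar R :=
  limn_esup (fun n => (maxE R w n)%:E).

Definition morph (S G : Type) (f : S -> seq G) (s : seq S) : seq G :=
  flatten (map f s).

(* u is the infinite word h(w) = h(w_0) h(w_1) ... *)
Definition is_image (S G : Type) (f : S -> seq G) (w : nat -> S) (u : nat -> G) : Prop :=
  forall n, morph f [seq w k | k <- iota 0 n] =
            [seq u i | i <- iota 0 (size (morph f [seq w k | k <- iota 0 n]))].

Definition ACE_I (R : realType) (S G : eqType) (w : nat -> S) : \bar R :=
  ereal_sup [set ACE R u | u in [set u : nat -> G |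
     exists f : S -> seq G, injective (morph f) /\ is_image f w u]].

Definition freq (R : realType) (A : eqType) (a : A) (f : seq A) : R :=
  (count_mem a f)%:R / (size f)%:R.

Definition freq_limsup (R : realType) (A : eqType) (w : nat -> A) (a : A) : \bar R :=
  ereal_inf [set ereal_sup [set (freq R a f)%:E | f in [set f | factor w f /\ (N <= size f)%N]]
            | N in [set: nat]].

Definition freq_liminf (R : realType) (A : eqType) (w : nat -> A) (a : A) : \bar R :=
  ereal_sup [set ereal_inf [set (freq R a f)%:E | f in [set f | factor w f /\ (N <= size f)%N]]
            | N in [set: nat]].

Definition uniform_freq (R : realType) (A : eqType) (w : nat -> A) : Prop :=
  forall a : A, (exists i, w i = a) -> freq_liminf R w a = freq_limsup R w a.

(* Main.v *)
Require Import Defs.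
From HB Require Import structures.
From mathcomp Require Import all_boot all_order all_algebra.
From mathcomp Require Import all_classical all_reals all_analysis.
From mathcomp Require Import zify ring lra.
Set Implicit Arguments. Unset Strict Implicit. Unset Printing Implicit Defensive.
Import Order.TTheory GRing.Theory Num.Theory.

(** An injective binary morphism [h] is conjugate to a morphism [g] with
    [h(c) z = z g(c)] whose letter images start with distinct letters, so the
    image word [u] is [z g(w)] and its parsing into blocks [g(w_n)] is
    deterministic. As [ACE(w)] is finite, [w] has no arbitrarily long factors
    of bounded period, and then neither has [u]. Hence in a long repetition of
    period [p] in [u] the parsings of the two shifted copies eventually share a
    cut, for otherwise their joint state would recur and force a bounded
    period. From there on the parsings run in parallel, so the repetition is,
    up to a bounded error, the image of a repetition [v^k v1] of [w] with
    [|h(v)| = p]. Its exponent [k + |h(v1)| / |h(v)|] is then controlled by: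
    uniform frequencies; or [|v1| = o(|v|)] when [ACE(w)] is an integer; or, in
    general, the fact that every window of bounded length in [w] contains both
    letters, which keeps [|h(v1)| / |h(v)|] away from [1] uniformly in [h]. *)

(** * Deterministic parsing *)

Local Open Scope nat_scope.

(* The factor of length [p + m] at position [i] has period [p]. *)
Definition rep (A : Type) (w : nat -> A) (i p m : nat) :=
  forall k, k < m -> w (i + k) = w (i + p + k).

(** Finiteness of ACE is used in this form: along any infinite family of ever longer repetitions the
    period must grow. *)
Definition bounded_runs (A : Type) (w : nat -> A) :=
  forall q, exists M, forall i p m, 0 < p <= q -> rep w i p m -> m <= M.

Lemma rep_shift (A : Type) (w : nat -> A) i p m d :
  rep w i p m -> rep w (i + d) p (m - d).
Proof.
move=> h k hk; have /h : d + k < m by lia.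
by rewrite !addnA [i + p + d]addnAC.
Qed.

Lemma rep_mul (A : Type) (w : nat -> A) i p m k :
  rep w i p m -> rep w i (k.+1 * p) (m - k * p).
Proof.
move=> h; elim: k => [|k IH] j hj; first by rewrite mul1n; apply: h; lia.
rewrite IH; last by nia.
have /h : k.+1 * p + j < m by nia.
by rewrite addnA => ->; congr w; lia.
Qed.

Lemma pigeonhole (T : finType) (F : nat -> T) :
  exists i j, [/\ i < j, j <= #|T| & F i = F j].
Proof.
have /injectivePn [x [y nxy e]] : ~~ injectiveb (fun i : 'I_#|T|.+1 => F i).
  apply/negP => /injectiveP /leq_card; rewrite card_ord; lia.
have := ltn_ord x; have := ltn_ord y.
case: (ltngtP x y) => [xy|yx|/val_inj xy] hy hx.
- by exists x, y; split => //; lia.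
- by exists y, x; split => //; lia.
- by rewrite xy eqxx in nxy.
Qed.

(** For [omega c = size (g c)] this is the length of the image under [g] of the factor of length [k]
    at [n]. *)
Definition wt (S : Type) (omega : S -> nat) (w : nat -> S) n k :=
  \sum_(0 <= i < k) omega (w (n + i)).

Section Weight.
Variables (S : Type) (omega : S -> nat) (w : nat -> S).

Lemma wtD n a b : wt omega w n (a + b) = wt omega w n a + wt omega w (n + a) b.
Proof.
rewrite /wt (big_cat_nat (n := a)) ?leq_addr //=; congr (_ + _).
rewrite -{1}(add0n a) big_addn addKn.
by apply: eq_bigr => i _; rewrite (addnC i) addnA.
Qed.

Lemma wt_rep n q m k : rep w n q m -> k <= m ->
  wt omega w (n + q) k = wt omega w n k.
Proof.
move=> hrep hk; apply: eq_big_nat => i /= hi.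
by rewrite hrep //; lia.
Qed.

Lemma wt_rep_mul n q m a b : rep w n q m -> a * q + b <= m + q ->
  wt omega w n (a * q + b) = a * wt omega w n q + wt omega w n b.
Proof.
move=> hrep; elim: a => [|a IH] h; first by rewrite !mul0n !add0n.
have h' : a * q + b <= m by rewrite mulSn in h; lia.
rewrite mulSn -addnA wtD (wt_rep hrep) // IH; lia.
Qed.

Lemma wt_ge n k : (forall c, 0 < omega c) -> k <= wt omega w n k.
Proof.
move=> h; elim: k => // k IH.
by rewrite /wt big_nat_recr //= -addn1 leq_add //; apply: h.
Qed.

Lemma wt_le B n k : (forall c, omega c <= B) -> wt omega w n k <= k * B.
Proof.
move=> h; elim: k => [|k IH]; first by rewrite /wt big_geq.
by rewrite /wt big_nat_recr //= mulSn addnC leq_add //; apply: h.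
Qed.

End Weight.

Section Parsing.
Variables (S : finType) (G : Type) (g : S -> seq G).
(** [P n] is the cut in [u] where the block of [w n] starts. [P 0] need not be 0: it is the length
    of the prefix [z] left over by the conjugation. *)
Variables (w : nat -> S) (u : nat -> G) (P : nat -> nat).
Hypothesis g_gt0 : forall c, 0 < size (g c).
Hypothesis g_marked : forall x0, injective (fun c => nth x0 (g c) 0).
Hypothesis P_S : forall n, P n.+1 = P n + size (g (w n)).
Hypothesis uP : forall n j, j < size (g (w n)) ->
  u (P n + j) = nth (u 0) (g (w n)) j.

Let B := \max_(c : S) size (g c).

Lemma size_image_letter_le c : size (g c) <= B.
Proof. exact: leq_bigmax. Qed.

Lemma cut_add_ge n k : P n + k <= P (n + k).
Proof.
elim: k => [|k IH]; first by rewrite !addn0.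
by rewrite !addnS P_S; have := g_gt0 (w (n + k)); lia.
Qed.

Lemma cut_add_le n k : P (n + k) <= P n + k * B.
Proof.
elim: k => [|k IH]; first by rewrite !addn0.
by rewrite !addnS P_S; have := size_image_letter_le (w (n + k)); lia.
Qed.

Lemma cut_block x : P 0 <= x -> exists n, P n <= x < P n.+1.
Proof.
move=> h0; have [n] : exists n, x < P n.
  by exists x.+1; have := cut_add_ge 0 x.+1; rewrite add0n; lia.
elim: n => [|n IH] hn; first lia.
by case: (leqP (P n) x) => hx; [exists n; apply/andP | apply: IH].
Qed.

Lemma cut_next i : exists n, i <= P n <= i + P 0 + B.
Proof.
case: (leqP (P 0) i) => h; last by exists 0; lia.
have [n /andP[h1 h2]] := cut_block h; exists n.+1.
by move: h2; rewrite P_S; have := size_image_letter_le (w n); lia.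
Qed.

(** The first letter of a block determines the block, so agreement at one pair of cuts forces equal
    blocks and hence agreement at the next pair. *)
Lemma parse_parallel n1 n2 D m j : P n2 = P n1 + D -> rep u (P n1) D m ->
  P (n1 + j) < P n1 + m ->
  w (n1 + j) = w (n2 + j) /\ P (n2 + j) = P (n1 + j) + D.
Proof.
move=> hD hrep; elim: j => [|j IH] hj.
  rewrite !addn0 in hj *; split => //; apply: (@g_marked (u 0)).
  rewrite /= -!uP // hD; apply: hrep; lia.
have hlt := cut_add_ge (n1 + j) 1; rewrite !addn1 in hlt.
rewrite !addnS in hj *.
have [|e1 e2] := IH; first lia.
have e3 : P (n2 + j).+1 = P (n1 + j).+1 + D by rewrite !P_S e2 -e1; lia.
split => //; apply: (@g_marked (u 0)).
rewrite /= -!uP // e3 !addn0.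
have hge := cut_add_ge n1 j.+1; rewrite !addnS in hge.
have /hrep : P (n1 + j).+1 - P n1 < m by lia.
by rewrite [P n1 + D + _]addnAC subnKC; last lia.
Qed.

(** Among [p + 1] consecutive cuts two are congruent modulo [p]. Their distance is again a period of
    [u], and parallel parsing turns it into a period at most [q] of [w]. *)
Lemma bounded_runs_image : bounded_runs w -> bounded_runs u.
Proof.
move=> hw q; have [M hM] := hw q.
exists (P 0 + B + 2 * q * B + (M.+1) * B) => i p m /andP[p0 pq] hrep.
rewrite leqNgt; apply/negP => hm.
have [n0 /andP[hn0 hn0']] := cut_next i.
have [a [b [ab hb /eqP hmod]]] :=
  pigeonhole (fun j => Ordinal (ltn_pmod (P (n0 + j)) p0)).
rewrite card_ord in hb.
have {}hmod : P (n0 + a) == P (n0 + b) %[mod p] := hmod.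
have le1 := cut_add_ge (n0 + a) (b - a).
rewrite -addnA subnKC in le1; last lia.
have le2 := cut_add_le n0 b.
have le3 := cut_add_ge n0 a.
rewrite eq_sym eqn_mod_dvd in hmod; last lia.
case/dvdnP: hmod => -[|k] hk; first lia.
pose D := P (n0 + b) - P (n0 + a).
have r1 : rep u (P (n0 + a)) D (m - (P (n0 + a) - i) - k * p).
  rewrite /D hk; apply: rep_mul.
  rewrite (_ : P (n0 + a) = i + (P (n0 + a) - i)) ?addKn; last lia.
  exact: rep_shift.
have := hM (n0 + a) (b - a) M.+1; rewrite ltnn => hF.
apply/notF/hF; first lia.
move=> j hj.
have hP : P (n0 + b) = P (n0 + a) + D by rewrite /D; lia.
have hbB : b * B <= q * B by rewrite leq_mul2r; lia.
have hjB : j * B <= M * B by rewrite leq_mul2r; lia.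
have B0 : 0 < B by have := size_image_letter_le (w 0); have := g_gt0 (w 0); lia.
have := cut_add_le (n0 + a) j => hj2.
have [|-> _] := parse_parallel (j := j) hP r1; first by lia.
by congr w; lia.
Qed.

(* If the two parsings never share a cut, every position is interior to a
   block of one of them, and interior letters are determined by the past: once
   the (letter, offset) state recurs, [u] is periodic with a bounded period. *)
Lemma parsings_synchronize : bounded_runs u -> exists L, forall i p m,
  rep u i p m -> L <= m ->
  exists n1 n2, i <= P n1 <= i + L /\ P n2 = P n1 + p.
Proof.
move=> hu; pose Q := #|{: S * 'I_B}| * B.
have [M hM] := hu Q.
(* [P 0 + B] reaches a first cut, [Q] covers the blocks up to the recurrence, and [M.+1] is one
   match more than period at most [Q] allows. *)
pose L := P 0 + 2 * B + Q + M.+1; exists L => i p m hrep hm.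
apply: contrapT => nosync.
have {}nosync n1 n2 : i <= P n1 <= i + L -> P n2 <> P n1 + p.
  by move=> h1 h2; apply: nosync; exists n1, n2.
have [n0 /andP[hn0 hn0']] := cut_next i.
(* [kk a] is the block containing the copy, shifted by [p], of the cut [n0 + a]; the offset in that
   block completes the state. *)
have /choice [kk hkk] : forall a, exists k, P k <= P (n0 + a) + p < P k.+1.
  move=> a; apply: cut_block.
  have := cut_add_ge 0 n0; have := cut_add_ge n0 a; rewrite add0n; lia.
have offB a : P (n0 + a) + p - P (kk a) < B.
  have := size_image_letter_le (w (kk a)).
  by case/andP: (hkk a); rewrite P_S; lia.
have [a [b [ab hb e]]] := pigeonhole (fun a => (w (kk a), Ordinal (offB a))).
case: e => ew eo.
have le1 := cut_add_ge (n0 + a) (b - a).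
rewrite -addnA subnKC in le1; last lia.
have le2 := cut_add_le n0 b.
have le3 := cut_add_ge n0 a.
have hbQ : b * B <= Q by rewrite leq_mul2r hb orbT.
pose n := n0 + a; pose k := kk a; pose j := P n + p - P k.
pose D := P (n0 + b) - P n.
case/andP: (hkk a) => ka1 ka2; case/andP: (hkk b) => kb1 kb2.
rewrite -/n -/k in le1 le3 ka1 ka2 ew eo.
have hj : j + P k = P n + p by rewrite /j; lia.
have hPn : P (n0 + b) = P n + D by rewrite /D; lia.
have hPk : P (kk b) = P k + D by rewrite /D; lia.
(* Equal offsets make [D] the displacement of both parsings. The period [D] is extended one letter
   at a time. *)
have per t : t <= M -> rep u (P n) D t.+1.
  elim/ltn_ind: t => t IH ht.
  have {}IH : rep u (P n) D t.
    by move=> s st; apply: (IH s) => //; lia.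
  move=> s; rewrite ltnS leq_eqVlt => /orP[/eqP-> {s}|]; last exact: IH.
  have [s /andP[s1 s2]] : exists s, P s <= P n + t < P s.+1.
    apply: cut_block; have := cut_add_ge 0 n; rewrite add0n; lia.
  have ns : n <= s.
    rewrite leqNgt; apply/negP => sn.
    by have := cut_add_ge s.+1 (n - s.+1); rewrite subnKC; lia.
  move: s1; rewrite leq_eqVlt => /orP[/eqP s1|s1].
    (* a cut of the first parsing, hence interior for the second one *)
    have [s' /andP[s1' s2']] : exists s', P s' <= P n + t + p < P s'.+1.
      apply: cut_block; have := cut_add_ge 0 n; rewrite add0n; lia.
    have ks : k <= s'.
      rewrite leqNgt; apply/negP => sn.
      by have := cut_add_ge s'.+1 (k - s'.+1); rewrite subnKC; lia.
    have ns' : P s' <> P s + p by apply: nosync; lia.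
    (* The first [j] letters lie in blocks of the same letter, [w k = w (kk b)]; the others are the
       induction hypothesis carried over by the shift [p]. *)
    have repk : rep u (P k) D (j + t).
      move=> y hy; case: (ltnP y j) => hyj.
        rewrite -hPk !uP ?ew //; rewrite -?ew; move: ka2; rewrite P_S; lia.
      have /IH : y - j < t by lia.
      have -> : P k + y = i + (P n + (y - j) - i) + p by lia.
      have -> : P k + D + y = i + (P n + D + (y - j) - i) + p
        by lia.
      rewrite ![i + _ + p]addnAC -!hrep; try by lia.
      by rewrite !subnKC //; lia.
    have [|e1 e2] := parse_parallel (j := s' - k) hPk repk.
      by rewrite subnKC //; lia.
    rewrite subnKC // in e1 e2.
    have eu : u (P n + t + p) = u (P n + D + t + p).
      have := @uP s' (P n + t + p - P s').
      rewrite subnKC // => ->; last by rewrite P_S in s2'; lia.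
      have := @uP (kk b + (s' - k)) (P n + t + p - P s').
      rewrite -e1 e2 => <-; last by rewrite P_S in s2'; lia.
      by congr u; lia.
    have := hrep (P n + t - i); have := hrep (P n + D + t - i).
    rewrite ![i + p + _]addnAC !subnKC; try by lia.
    by move=> h1 h2; rewrite h2 ?h1 ?hPn //; lia.
  (* Here the position is interior to the block [s] of the first parsing, whose first letter is
     already covered by the induction hypothesis. *)
  have [|e1 e2] := parse_parallel (j := s - n) hPn IH.
    by rewrite subnKC; lia.
  rewrite subnKC // in e1 e2.
  have := @uP s (P n + t - P s).
  rewrite subnKC; last lia.
  move=> ->; last by rewrite P_S in s2; lia.
  have := @uP (n0 + b + (s - n)) (P n + t - P s).
  rewrite -e1 e2 => <-; last by rewrite P_S in s2; lia.
  by congr u; lia.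
have := hM (P n) D M.+1; rewrite ltnn => hF.
by apply/notF/hF; [rewrite /D; lia | exact: per].
Qed.

Lemma cut_wt n k : P (n + k) = P n + wt (fun c => size (g c)) w n k.
Proof.
elim: k => [|k IH]; first by rewrite /wt big_geq // !addn0.
by rewrite addnS P_S IH /wt big_nat_recr //= addnA.
Qed.

(** From the common cut on the two copies have the same blocks. The loss [C] comes only from the
    part before that cut, so it depends neither on [p] nor on [m]. *)
Lemma repetition_pullback : bounded_runs w ->
  exists C, forall i p m, 0 < p -> rep u i p m -> C <= m ->
  exists n q m', [/\ 0 < q, rep w n q m', wt (fun c => size (g c)) w n q = p
    & m <= wt (fun c => size (g c)) w n m' + C].
Proof.
move=> /bounded_runs_image /parsings_synchronize [L hL].
exists L.+1 => i p m p0 hrep hm.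
have [|n1 [n2 [/andP[i1 i2] hP]]] := hL _ _ _ hrep; first lia.
have n12 : n1 < n2.
  rewrite ltnNge; apply/negP => n21.
  by have := cut_add_ge n2 (n1 - n2); rewrite subnKC; lia.
have r1 : rep u (P n1) p (m - (P n1 - i)).
  rewrite -{1}(subnKC i1); exact: rep_shift.
(* [s] is the block of the last matched position: it starts inside the match, and its end may
   overshoot. *)
have [s /andP[s1 s2]] : exists s, P s <= (i + m).-1 < P s.+1.
  by apply: cut_block; have := cut_add_ge 0 n1; rewrite add0n; lia.
have n1s : n1 <= s.
  rewrite leqNgt; apply/negP => sn.
  by have := cut_add_ge s.+1 (n1 - s.+1); rewrite subnKC; lia.
exists n1, (n2 - n1), (s.+1 - n1); split; first lia.
- move=> j hj.
  have := cut_add_ge (n1 + j) (s - n1 - j).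
  rewrite (_ : n1 + j + (s - n1 - j) = s); last lia.
  move=> hjs; have [|-> _] := parse_parallel (j := j) hP r1; first lia.
  by congr w; lia.
- by have := cut_wt n1 (n2 - n1); rewrite subnKC; lia.
- by have := cut_wt n1 (s.+1 - n1); rewrite subnKC; lia.
Qed.

End Parsing.

(** * Conjugation to a marked morphism *)

Lemma prefix_trichotomy (G : eqType) (x y : seq G) :
  [\/ prefix x y, prefix y x |
   exists z a b x1 y1, [/\ x = z ++ a :: x1, y = z ++ b :: y1 & a <> b]].
Proof.
elim: x y => [|a x IH] [|b y]; [by constructor 1|by constructor 1|by constructor 2|].
case: (eqVneq a b) => [<-|/eqP ab]; last first.
  by constructor 3; exists [::], a, b, x, y.
have [h|h|[z [c [d [x1 [y1 [-> -> cd]]]]]]] := IH y.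
- by constructor 1; rewrite /= eqxx.
- by constructor 2; rewrite /= eqxx.
- by constructor 3; exists (a :: z), c, d, x1, y1.
Qed.

(* [z] is the longest common prefix of [x ++ y] and [y ++ x]. *)
Lemma conjugate_marked (G : eqType) (x y : seq G) : x ++ y <> y ++ x ->
  exists z x' y', [/\ x ++ z = z ++ x', y ++ z = z ++ y' &
    exists a b s t, [/\ x' = a :: s, y' = b :: t & a <> b]].
Proof.
have [n] := ubnP (size x + size y); elim: n x y => // n IH x y hn nxy.
have x0 : 0 < size x by case: x nxy {hn} => //; rewrite cats0.
have y0 : 0 < size y by case: y nxy {hn} => //; rewrite cats0.
case: (prefix_trichotomy x y) => [/prefixP[t e]|/prefixP[t e]|].
(* A Euclidean step to the shorter pair [x], [t], which does not commute either; its conjugating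
   word is then preceded by [x]. *)
- subst y; rewrite size_cat in hn.
  have [||z [x' [y' [e1 e2 [a [b [s [r [es er ab]]]]]]]]] := IH x t; first lia.
    by move=> e; apply: nxy; rewrite -catA e.
  exists (x ++ z), x', (y' ++ x'); split.
  + by rewrite e1 !catA e1.
  + by rewrite -catA {1}e1 (catA t) e2 !catA.
  + by exists a, b, s, (r ++ x'); rewrite er.
- subst x; rewrite size_cat in hn.
  have [||z [x' [y' [e1 e2 [a [b [s [r [es er ab]]]]]]]]] := IH t y; first lia.
    by move=> e; apply: nxy; rewrite -catA e.
  exists (y ++ z), (x' ++ y'), y'; split.
  + by rewrite -catA {1}e2 (catA t) e1 !catA.
  + by rewrite e2 !catA e2.
  + by exists a, b, (s ++ y'), r; rewrite es.
- move=> [z [a [b [x1 [y1 [-> -> ab]]]]]].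
  exists z, (a :: x1 ++ z), (b :: y1 ++ z); split; rewrite -?catA //.
  by exists a, b, (x1 ++ z), (y1 ++ z).
Qed.

Lemma two_letters (S : finType) : #|S| = 2 ->
  exists a b : S, a <> b /\ forall c, c = a \/ c = b.
Proof.
move=> h2; have := h2; rewrite cardT.
case e : (enum S) => [|a [|b []]] // _.
exists a, b; split.
  by have := enum_uniq S; rewrite e /= inE andbT => /eqP.
move=> c; have : c \in enum S by rewrite mem_enum.
by rewrite e !inE => /orP[] /eqP; [left|right].
Qed.

(** Injectivity distinguishes the images of [ab] and [ba], so the images of the two letters do not
    commute. *)
Lemma injective_morph_marked (S : finType) (G : eqType) (h : S -> seq G) :
  #|S| = 2 -> injective (morph h) ->
  exists z (g : S -> seq G), [/\ forall c, h c ++ z = z ++ g c,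
    forall c, 0 < size (g c) & forall x0, injective (fun c => nth x0 (g c) 0)].
Proof.
move=> /two_letters [a [b [ab hab]]] hinj.
have nc : h a ++ h b <> h b ++ h a.
  move=> e; have /hinj[] : morph h [:: a; b] = morph h [:: b; a].
    by rewrite /morph /= !cats0.
  by move=> /ab.
have [z [x [y [ex ey [p [q [s [t [xE yE pq]]]]]]]]] := conjugate_marked nc.
have [ab1 ab2] : (b == a) = false /\ (a == b) = false.
  by split; apply/eqP => // e; apply: ab.
exists z, (fun c => if c == a then x else y); split.
- by move=> c; case: (hab c) => ->; rewrite ?eqxx ?ab1.
- by move=> c; case: (c == a); rewrite ?xE ?yE.
- move=> x0 c d; case: (hab c) => ->; case: (hab d) => -> //=;
  by rewrite ?eqxx ?ab1 xE yE /= => e; case: pq.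
Qed.

Lemma morph_cat (S G : Type) (h : S -> seq G) s t :
  morph h (s ++ t) = morph h s ++ morph h t.
Proof. by rewrite /morph map_cat flatten_cat. Qed.

Lemma image_parse (S G : Type) (h g : S -> seq G) z (w : nat -> S) u :
  (forall c, h c ++ z = z ++ g c) -> (forall c, 0 < size (g c)) ->
  is_image h w u ->
  exists P : nat -> nat, (forall n, P n.+1 = P n + size (g (w n))) /\
    forall n j, j < size (g (w n)) -> u (P n + j) = nth (u 0) (g (w n)) j.
Proof.
move=> hg g0 hu.
have hgs s : morph h s ++ z = z ++ morph g s.
  elim: s => [|c s IH]; first by rewrite cats0.
  by rewrite /morph /= -catA [flatten _ ++ z]IH !catA hg.
have szs s : size (morph h s) = size (morph g s).
  by have := congr1 size (hgs s); rewrite !size_cat; lia.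
pose A n := morph g [seq w k | k <- iota 0 n].
have AS n : A n.+1 = A n ++ g (w n).
  by rewrite /A -addn1 iotaD map_cat morph_cat /morph /= cats0.
have szA n : n <= size (A n).
  elim: n => // n IH; rewrite AS size_cat; have := g0 (w n); lia.
have Acat n k : exists t, A (n + k) = A n ++ t.
  elim: k => [|k [t IH]]; first by exists [::]; rewrite addn0 cats0.
  by exists (t ++ g (w (n + k))); rewrite addnS AS IH catA.
exists (fun n => size z + size (A n)); split=> [n|n j hj].
  by rewrite AS size_cat addnA.
set x := size z + size (A n) + j.
(* Blocks are nonempty, so the image of the first [x.+1] letters reaches beyond position [x]. *)
have hn : n < x.+1 by have := szA n; rewrite /x; lia.
have hx : x < size (A x.+1) by exact: szA.
have hux : u x = nth (u 0) (morph h [seq w k | k <- iota 0 x.+1]) x.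
  by rewrite hu (nth_map 0) ?nth_iota ?size_iota ?szs.
rewrite hux.
have -> : nth (u 0) (morph h [seq w k | k <- iota 0 x.+1]) x =
          nth (u 0) (z ++ A x.+1) x.
  by rewrite -hgs nth_cat szs hx.
have [t] := Acat n.+1 (x - n); rewrite addSn subnKC; last lia.
move=> ->; rewrite AS -!catA nth_cat ltnNge /x -addnA leq_addr /= addKn.
by rewrite nth_cat ltnNge leq_addr /= addKn nth_cat hj.
Qed.

(** * Critical exponents and repetitions *)

Lemma size_vpow (A : Type) (v : seq A) p : 0 < size v -> size (vpow v p) = p.
Proof.
move=> v0; rewrite /vpow size_takel // size_flatten /shape map_nseq sumn_nseq.
exact: leq_pmull.
Qed.

Lemma nth_vpow (A : Type) x0 (v : seq A) p k : 0 < size v -> k < p ->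
  nth x0 (vpow v p) k = nth x0 v (k %% size v).
Proof.
move=> v0 kp; rewrite /vpow nth_take //.
have : k < p * size v by apply: leq_trans kp (leq_pmulr _ v0).
elim: p k {kp} => // p IH k; rewrite mulSn => hk /=.
rewrite nth_cat; case: ltnP => h; first by rewrite modn_small.
rewrite IH; last lia.
by rewrite -{2}(subnK h) modnDr.
Qed.

Definition segment (A : Type) (w : nat -> A) i n :=
  [seq w (i + k) | k <- iota 0 n].

Lemma size_segment (A : Type) (w : nat -> A) i n : size (segment w i n) = n.
Proof. by rewrite size_map size_iota. Qed.

Lemma nth_segment (A : Type) x0 (w : nat -> A) i n k : k < n ->
  nth x0 (segment w i n) k = w (i + k).
Proof. by move=> kn; rewrite (nth_map 0) ?size_iota // nth_iota. Qed.

Lemma factor_segment (A : Type) (w : nat -> A) i n : Defs.factor w (segment w i n).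
Proof. by exists i; rewrite size_segment. Qed.

Lemma vpow_rep (A : Type) (w : nat -> A) v i n : 0 < size v ->
  segment w i n = vpow v n -> rep w i (size v) (n - size v).
Proof.
move=> v0 e k hk; rewrite -addnA.
rewrite -!(@nth_segment _ (w 0) w i n) ?e; [|lia..].
by rewrite !nth_vpow ?modnDl //; lia.
Qed.

Lemma rep_vpow (A : Type) (w : nat -> A) i p m : 0 < p -> rep w i p m ->
  segment w i (p + m) = vpow (segment w i p) (p + m).
Proof.
move=> p0 hrep; apply: (@eq_from_nth _ (w 0)).
  by rewrite size_vpow !size_segment.
move=> k; rewrite size_segment => hk.
rewrite nth_vpow ?size_segment // !nth_segment // ?ltn_pmod //.
elim/ltn_ind: k hk => k IH hk.
case: (ltnP k p) => kp; first by rewrite modn_small.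
rewrite -{1}(subnKC kp) addnA -hrep; last lia.
by rewrite IH; [rewrite -{2}(subnK kp) modnDr|lia|lia].
Qed.

Local Open Scope classical_set_scope.
Local Open Scope ring_scope.

(** The inequality [ACE R w <= c] without suprema: a factor of length [p + m] with period [p] has
    exponent [(p + m) / p]. *)
Definition exponent_bound (R : realType) (A : Type) (w : nat -> A) (c : R) :=
  forall eps : R, 0 < eps -> exists N : nat, forall i p m : nat,
    (0 < p)%N -> (N <= p + m)%N -> rep w i p m ->
    (p + m)%:R <= (c + eps) * p%:R.

Section CriticalExponent.
Variables (R : realType) (A : Type).

Lemma E_ubound (x : seq A) : ubound [set r : R | exists (v : seq A) (p : nat),
  v <> [::] /\ x = vpow v p /\ r = p%:R / (size v)%:R] (size x)%:R.
Proof.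
move=> _ [v [p [v0 [-> ->]]]]; case: v v0 => [//|a v] _; rewrite size_vpow //.
rewrite ler_pdivrMr ?ltr0n // -natrM ler_nat.
exact: leq_pmulr.
Qed.

Lemma E_ge (v : seq A) p : v <> [::] -> p%:R / (size v)%:R <= E R (vpow v p).
Proof.
move=> v0; apply: ub_le_sup; last by exists v, p.
by exists (size (vpow v p))%:R; exact: E_ubound.
Qed.

Lemma E_le_size (x : seq A) : (0 < size x)%N -> E R x <= (size x)%:R.
Proof.
move=> x0; apply: ge_sup; last exact: E_ubound.
have xE : x = vpow x (size x).
  case: x x0 => [//|a x] _; apply: (@eq_from_nth _ a); rewrite ?size_vpow //.
  by move=> i hi; rewrite nth_vpow // modn_small.
exists ((size x)%:R / (size x)%:R), x, (size x); split=> //.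
by move=> e; rewrite e in x0.
Qed.

Lemma maxE_leP (w : nat -> A) n (d : R) : (0 < n)%N ->
  maxE R w n <= d <->
  (forall i p m, (0 < p)%N -> (p + m)%N = n -> rep w i p m ->
     n%:R <= d * p%:R).
Proof.
move=> n0; split=> [hd i p m p0 pm hrep|h].
  rewrite -ler_pdivrMr ?ltr0n //; apply: le_trans hd.
  have sE : segment w i n = vpow (segment w i p) n.
    by rewrite -pm; exact: rep_vpow.
  have := @E_ge (segment w i p) n; rewrite size_segment => hE.
  apply: (le_trans (hE _)).
    by move=> e; have := size_segment w i p; rewrite e => e0; rewrite -e0 in p0.
  rewrite -sE; apply: ub_le_sup.
    exists n%:R => _ [x [_ xn] <-].
    by rewrite -[X in _ <= X%:R]xn; apply: E_le_size; rewrite xn.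
  exists (segment w i n) => //; split; first exact: factor_segment.
  exact: size_segment.
apply: ge_sup.
  exists (E R (segment w 0 n)), (segment w 0 n) => //.
  split; first exact: factor_segment.
  exact: size_segment.
move=> _ [x [[i xE] xn] <-]; rewrite xn in xE; rewrite xE -/(segment w i n).
(* The factor as its own period, [m = 0], gives [1 <= d]; this settles the roots [v] longer than the
   factor. *)
have d1 : 1 <= d.
  have := h 0%N n 0%N n0 (addn0 n).
  by rewrite -{1}[n%:R]mul1r ler_pM2r ?ltr0n //; apply => k.
apply: ge_sup.
  have sE := @rep_vpow _ w i n 0 n0 (fun k hk => False_ind _ (notF hk)).
  rewrite addn0 in sE.
  exists (n%:R / n%:R), (segment w i n), n; rewrite size_segment; split=> //.
  by move=> e; have := size_segment w i n; rewrite e => e0; rewrite -e0 in n0.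
move=> _ [v [p [v0 [e ->]]]].
have {}v0 : (0 < size v)%N by case: v v0 {e}.
have pn : p = n by rewrite -(size_segment w i n) e size_vpow.
subst p; rewrite ler_pdivrMr ?ltr0n //.
case: (leqP (size v) n) => vn; last first.
  apply: (@le_trans _ _ (1 * (size v)%:R)); first by rewrite mul1r ler_nat ltnW.
  by rewrite ler_pM2r ?ltr0n.
by apply: (h i (size v) (n - size v)%N) => //; [lia|exact: vpow_rep].
Qed.

Lemma ACE_leP (w : nat -> A) (c : R) :
  (ACE R w <= c%:E)%E <-> exponent_bound w c.
Proof.
split=> [hA eps eps0|h].
  have /ereal_inf_lt[_ [V [N _ hN] <-] hV] : (ACE R w < (c + eps)%:E)%E.
    by apply: le_lt_trans hA _; rewrite lte_fin ltrDl.
  exists N => i p m p0 pm hrep.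
  have : maxE R w (p + m) <= c + eps.
    rewrite -lee_fin; apply: le_trans (ltW hV).
    by apply: ereal_sup_ubound; exists (p + m)%N => //; apply: hN.
  move/maxE_leP => hm; apply: hm hrep => //; lia.
apply/lee_addgt0Pr => eps eps0; have [N hN] := h eps eps0.
apply: ge_ereal_inf.
exists (ereal_sup [set (maxE R w n)%:E | n in [set n | (N.+1 <= n)%N]]).
  exists [set n | (N.+1 <= n)%N] => //; exact: nbhs_infty_ge.
apply: ge_ereal_sup => _ [n /= hn <-]; rewrite -EFinD lee_fin.
apply/maxE_leP; first lia.
by move=> i p m p0 pm hrep; rewrite -pm; apply: hN hrep => //; lia.
Qed.

Lemma exponent_bound_ge1 (w : nat -> A) (c : R) : exponent_bound w c -> 1 <= c.
Proof.
move=> h; apply/ler_addgt0Pr => eps eps0; have [N hN] := h eps eps0.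
have := hN 0%N N.+1 0%N isT; rewrite addn0 => /(_ (leqnSn _)) h1.
rewrite -(@ler_pM2r _ N.+1%:R) ?ltr0n // mul1r; apply: h1 => k.
by rewrite ltn0.
Qed.

Lemma exponent_bound_bounded_runs (w : nat -> A) (c : R) :
  exponent_bound w c -> bounded_runs w.
Proof.
move=> h q; have c1 := exponent_bound_ge1 h.
have [N hN] := h 1 ltr01.
exists (N + Num.truncn ((c + 1) * q%:R)).+1%N => i p m /andP[p0 pq] hrep.
case: (leqP N (p + m)) => hpm; last lia.
have := hN _ _ _ p0 hpm hrep => h1.
have h2 : (p + m)%:R <= (c + 1) * q%:R.
  by apply: le_trans h1 _; rewrite ler_pM2l ?ler_nat //; lra.
have : (p + m)%:R < (Num.truncn ((c + 1) * q%:R)).+1%:R :> R.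
  by apply: le_lt_trans h2 _; exact: truncnS_gt.
rewrite ltr_nat; lia.
Qed.

End CriticalExponent.

(** A letter-to-letter map preserves every repetition. *)
Lemma ACE_map_ge (R : realType) (A B : Type) (f : A -> B) (w : nat -> A) :
  (ACE R w <= ACE R (f \o w))%E.
Proof.
case e : (ACE R (f \o w)) => [c||]; last 1 first.
- have /exponent_bound_ge1 : exponent_bound (f \o w) (0 : R).
    by apply/ACE_leP; rewrite e leNye.
  by rewrite ler10.
- have /ACE_leP h : (ACE R (f \o w) <= c%:E)%E by rewrite e.
  apply/ACE_leP => eps /h [N hN]; exists N => i p m p0 pm hr.
  by apply: (hN i) => // k /hr /= ->.
- by rewrite leey.
Qed.

(** * Weighted exponents *)

(** [m] counts matches beyond the first period, so [d] bounds the exponent of the image minus 1; [K]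
    absorbs bounded errors. *)
Definition weight_ratio_bound (R : realType) (S : Type) (omega : S -> nat)
    (w : nat -> S) (d : R) :=
  forall eps : R, 0 < eps -> exists N K : nat, forall n q m : nat,
    (N <= q)%N -> rep w n q m ->
    (wt omega w n m)%:R <= (d + eps) * (wt omega w n q)%:R + K%:R.

(** Bounded runs of [u] make [p] large in a long repetition. Then [q] is at least [N], and the
    additive constants are at most [eps / 2 * p]. *)
Lemma image_exponent_bound (R : realType) (S G : Type) (omega : S -> nat) B
    (w : nat -> S) (u : nat -> G) (c : R) :
  1 <= c -> (forall x, omega x <= B)%N -> bounded_runs u ->
  (exists C, forall i p m, (0 < p)%N -> rep u i p m -> (C <= m)%N ->
    exists n q m', [/\ (0 < q)%N, rep w n q m', wt omega w n q = p
      & (m <= wt omega w n m' + C)%N]) ->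
  weight_ratio_bound omega w (c - 1) -> exponent_bound u c.
Proof.
move=> c1 hB hu [C hC] hw eps eps0.
have eps20 : 0 < eps / 2 by lra.
have [N [K hNK]] := hw _ eps20.
set T := (Num.truncn ((K + C)%:R / (eps / 2))).+1.
have [M hM] := hu (N * B + T)%N.
exists (N * B + T + M).+1 => i p m p0 hpm hrep.
have hp : (N * B + T < p)%N.
  rewrite ltnNge; apply/negP => hp.
  by have := hM i p m; rewrite p0 hp => /(_ isT hrep); lia.
have hKC : (K + C)%:R <= eps / 2 * p%:R.
  rewrite mulrC -ler_pdivrMr //; apply: ltW.
  have h1 : (K + C)%:R / (eps / 2) < T%:R by exact: truncnS_gt.
  by apply: lt_le_trans h1 _; rewrite ler_nat; lia.
rewrite natrD in hKC; rewrite natrD.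
have pp : 0 <= (c - 1) * p%:R by rewrite mulr_ge0 // subr_ge0.
have ep : 0 <= eps * p%:R by rewrite mulr_ge0 // ltW.
have K0 : 0 <= K%:R :> R by [].
case: (leqP C m) => hm; last first.
  have : m%:R <= C%:R :> R by rewrite ler_nat ltnW.
  lra.
have [n [q [m' [q0 hr hq hm']]]] := hC _ _ _ p0 hrep hm.
have Nq : (N <= q)%N.
  rewrite leqNgt; apply/negP => qN.
  have := wt_le w n q hB; rewrite hq => h1.
  have : (q * B <= N * B)%N by rewrite leq_mul2r (ltnW qN) orbT.
  lia.
have := hNK _ _ _ Nq hr; rewrite hq.
have : m%:R <= (wt omega w n m')%:R + C%:R :> R by rewrite -natrD ler_nat.
lra.
Qed.

Section RatioBounds.
Variables (R : realType) (S : finType) (omega : S -> nat) (w : nat -> S).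
Hypothesis omega_gt0 : forall c, (0 < omega c)%N.

Lemma wt_mono n a b : (a <= b)%N -> (wt omega w n a <= wt omega w n b)%N.
Proof. by move=> /subnKC <-; rewrite wtD leq_addr. Qed.

(** Peels off [k] periods. If [m < k * q], the truncated difference is 0 and at most [k] periods
    cover [m]. *)
Lemma wt_rep_split n q m k : (0 < q)%N -> rep w n q m ->
  (wt omega w n m <= k * wt omega w n q + wt omega w n (m - k * q))%N.
Proof.
move=> q0 hrep; case: (leqP (k * q) m) => h.
  by rewrite -{1}(subnKC h) (wt_rep_mul _ hrep) //; lia.
rewrite {1}(divn_eq m q) (wt_rep_mul _ hrep); last by rewrite -divn_eq leq_addr.
have h1 : (m %/ q < k)%N by rewrite ltn_divLR.
have h2 : (wt omega w n (m %% q) <= wt omega w n q)%N.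
  by rewrite wt_mono // ltnW // ltn_pmod.
have : ((m %/ q).+1 * wt omega w n q <= k * wt omega w n q)%N.
  by rewrite leq_mul2r h1 orbT.
rewrite mulSn; lia.
Qed.

Lemma excess_le (q m k : nat) (tau : R) : 0 <= tau ->
  (q + m)%:R <= (k.+1%:R + tau) * q%:R -> (m - k * q)%:R <= tau * q%:R.
Proof.
move=> tau0; case: (leqP (k * q) m) => h.
  rewrite natrB // natrD natrM -natr1; lra.
by move=> _; rewrite (eqP (ltnW h)) mulr_ge0.
Qed.

(** Beyond [k] full periods only a small fraction of [q] letters is left. Each weighs at most [B],
    while the period weighs at least [q]. *)
Lemma weight_ratio_bound_integer k : exponent_bound w (k.+1%:R : R) ->
  weight_ratio_bound omega w (k%:R : R).
Proof.
move=> hw eps eps0; pose B := \max_(c : S) omega c.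
have hB c : (omega c <= B)%N by exact: leq_bigmax.
have e0 : 0 < eps / B.+1%:R by rewrite divr_gt0 // ltr0n.
have [N hN] := hw _ e0.
exists N.+1, 0%N => n q m hq hrep; rewrite addr0.
have q0 : (0 < q)%N by lia.
have := hN n q m q0 _ hrep; move=> /(_ _)/(excess_le (ltW e0)) hb.
have {}hb : (m - k * q)%:R <= eps / B.+1%:R * q%:R by apply: hb; lia.
have := wt_rep_split k q0 hrep; rewrite -(ler_nat R) natrD natrM => h1.
have h2 : (wt omega w n (m - k * q))%:R <= (m - k * q)%:R * B.+1%:R :> R.
  rewrite -natrM ler_nat; apply: leq_trans (wt_le w n _ hB) _.
  by rewrite leq_mul2l leqnSn orbT.
have h3 : (m - k * q)%:R * B.+1%:R <= eps * q%:R.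
  by rewrite -ler_pdivlMr ?ltr0n // mulrAC.
have h4 : eps * q%:R <= eps * (wt omega w n q)%:R.
  by rewrite ler_pM2l // ler_nat wt_ge.
lra.
Qed.

Lemma wt_window (K n : nat) : (forall c, exists2 i, (i < K)%N & w (n + i) = c) ->
  (\sum_c omega c <= wt omega w n K)%N.
Proof.
move=> h; rewrite /wt big_mkord.
rewrite (partition_big (fun i : 'I_K => w (n + i)) xpredT) //=.
apply: leq_sum => c _; have [i iK <-] := h c.
by rewrite (bigD1 (Ordinal iK)) //= leq_addr.
Qed.

(** Cut the factor into disjoint windows of length [K], each containing every letter; the last term
    pays for the incomplete window. *)
Lemma wt_windows (K n l : nat) :
  (forall n c, exists2 i, (i < K)%N & w (n + i) = c) ->
  (l * \sum_c omega c <= K * wt omega w n l + K * \sum_c omega c)%N.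
Proof.
move=> h; set T := (\sum_c _)%N.
have K0 : (0 < K)%N by have [i] := h 0%N (w 0); case: (K).
have h1 a : (a * T <= wt omega w n (a * K))%N.
  elim: a => // a IH; rewrite !mulSnr wtD.
  by apply: leq_add => //; apply: wt_window; apply: h.
have h2 : (l %/ K * T <= wt omega w n l)%N.
  by apply: leq_trans (h1 _) _; apply: wt_mono; exact: leq_divM.
have h3 : (l <= K * (l %/ K).+1)%N by rewrite mulnC ltnW // ltn_ceil.
have : (l * T <= K * (l %/ K).+1 * T)%N by rewrite leq_mul2r h3 orbT.
have : (K * (l %/ K * T) <= K * wt omega w n l)%N by rewrite leq_mul2l h2 orbT.
by rewrite -mulnA mulSn mulnDr; lia.
Qed.

(* The bound does not depend on [omega]: writing the repetition as [v^j v1]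
   with [v = v1 v2], the windows inside [v2] weigh a fixed proportion of the
   largest possible weight of [v1]. *)
Lemma weight_ratio_bound_noninteger (K k : nat) (r : R) :
  (forall n c, exists2 i, (i < K)%N & w (n + i) = c) ->
  k.+1%:R <= r -> r < k.+2%:R -> exponent_bound w r ->
  let rho := 2 * K%:R / ((k.+2%:R - r) / 2) in
  weight_ratio_bound omega w (k%:R + rho / (1 + rho)).
Proof.
move=> hK kr rk hw rho eps eps0.
(* [k.+1%:R + tau] is the midpoint of [r] and [k.+2%:R], so the excess over [k] periods is at most
   [tau * q] with [tau < 1]. *)
pose tau : R := (r - k%:R) / 2.
have k1 : k.+1%:R = k%:R + 1 :> R by rewrite -natr1.
have k2 : k.+2%:R = k%:R + 2 :> R by rewrite -addn2 natrD.
have tau0 : 0 <= tau by rewrite /tau; lra.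
have tau1 : 0 < 1 - tau by rewrite /tau; lra.
have rhoE : rho = 2 * K%:R / (1 - tau).
  by rewrite /rho /tau; congr (_ / _); lra.
have e0 : 0 < (k.+2%:R - r) / 2 by lra.
have [N hN] := hw _ e0.
(* The second summand gives [q > rho], so that the incomplete window costs at most half of
   [(1 - tau) * q] in [hqz]. *)
exists (N + (Num.truncn rho).+1)%N, 0%N => n q m hq hrep; rewrite addr0.
have q0 : (0 < q)%N by lia.
set b := (m - k * q)%N.
have hb : b%:R <= tau * q%:R.
  apply: excess_le => //.
  have := hN n q m q0 _ hrep => /(_ _)/le_trans; apply; first lia.
  by rewrite ler_pM2r ?ltr0n // /tau; lra.
have bq : (b <= q)%N.
  rewrite -(ler_nat R); apply: le_trans hb _.
  by rewrite ler_piMl //; lra.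
set T := (\sum_c omega c)%N.
have T0 : 0 <= T%:R :> R by [].
have hT c : (omega c <= T)%N by rewrite /T (bigD1 c) //= leq_addr.
(* [y] is the weight of [v1] and [z] that of [v2]; the aim is [y <= rho * z]. *)
pose y := wt omega w n b; pose z := wt omega w (n + b) (q - b).
have pE : wt omega w n q = (y + z)%N by rewrite -wtD subnKC.
have hy : y%:R <= b%:R * T%:R :> R by rewrite -natrM ler_nat; exact: wt_le.
have hz : (q%:R - b%:R) * T%:R <= K%:R * z%:R + K%:R * T%:R :> R.
  by rewrite -natrB // -!natrM -natrD ler_nat; exact: wt_windows.
have rho0 : 0 <= rho by rewrite rhoE divr_ge0 ?mulr_ge0 //; exact: ltW.
have hqK : 2 * K%:R <= (1 - tau) * q%:R.
  rewrite mulrC [leRHS]mulrC -ler_pdivrMr // mulrC -rhoE; apply: ltW.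
  apply: lt_le_trans (truncnS_gt rho) _; rewrite ler_nat.
  exact: leq_trans (leq_addl _ _) hq.
have hbT : b%:R * T%:R <= tau * q%:R * T%:R by rewrite ler_wpM2r.
have hqT : 2 * K%:R * T%:R <= (1 - tau) * q%:R * T%:R by rewrite ler_wpM2r.
have hqz : q%:R * T%:R <= rho * z%:R.
  rewrite rhoE -(ler_pM2l tau1) mulrA mulrA mulrCA divff ?gt_eqF // mulr1; lra.
have hyz : y%:R <= rho * z%:R.
  apply: le_trans hy (le_trans _ hqz).
  by rewrite ler_wpM2r // ler_nat.
have hyp : y%:R <= rho / (1 + rho) * (y + z)%:R.
  rewrite mulrAC ler_pdivlMr ?natrD; lra.
have := wt_rep_split k q0 hrep; rewrite -(ler_nat R) natrD natrM -/b -/y.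
rewrite -pE in hyp.
have : 0 <= eps * (wt omega w n q)%:R by rewrite mulr_ge0 // ltW.
lra.
Qed.

(** Weight is asymptotically [lam] times length, uniformly in the position, so ratios of weights
    approach ratios of lengths. *)
Lemma weight_ratio_bound_uniform (r lam : R) :
  exponent_bound w r ->
  (forall delta : R, 0 < delta -> exists N : nat, forall n k : nat,
     (N <= k)%N -> `|(wt omega w n k)%:R - lam * k%:R| <= delta * k%:R) ->
  weight_ratio_bound omega w (r - 1).
Proof.
move=> hw hlam eps eps0; have r1 := exponent_bound_ge1 hw.
pose B := \max_(c : S) omega c.
have hB c : (omega c <= B)%N by exact: leq_bigmax.
have lam0 : 0 < lam.
  have h20 : 0 < 2^-1 :> R by [].
  have [N hN] := hlam _ h20.
  have := hN 0%N N.+1 (leqnSn _); rewrite ler_norml => /andP[_].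
  have := wt_ge w 0 N.+1 omega_gt0; rewrite -(ler_nat R) => h1 h2.
  have N0 : 0 < N.+1%:R :> R by rewrite ltr0n.
  rewrite -(pmulr_lgt0 _ N0); lra.
have D0 : 0 < 4 * (r - 1) + 3 * eps by lra.
(* Solves [(lam + delta) * (r - 1 + eps / 2) = (r - 1 + eps) * (lam - delta)]. *)
pose delta := lam * eps / (4 * (r - 1) + 3 * eps).
have delta0 : 0 < delta by rewrite divr_gt0 ?mulr_gt0.
have deltaE : delta * (4 * (r - 1) + 3 * eps) = lam * eps.
  by rewrite /delta mulfVK // gt_eqF.
have e0 : 0 < eps / 2 by lra.
have [N1 hN1] := hw _ e0; have [N2 hN2] := hlam _ delta0.
(* [N2 * B] bounds the weight when [m < N2], where the average says nothing. *)
exists (N1 + N2 + 1)%N, (N2 * B)%N => n q m hq hrep.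
have q0 : (0 < q)%N by lia.
have hm : m%:R <= (r - 1 + eps / 2) * q%:R.
  have := hN1 n q m q0 _ hrep => /(_ _); rewrite natrD => h1.
  have {}h1 := h1 ltac:(lia); lra.
have hq2 : (lam - delta) * q%:R <= (wt omega w n q)%:R.
  have := hN2 n q; rewrite ler_norml => /(_ _)/andP h1.
  have [h2 _] := h1 ltac:(lia); lra.
have hm2 : (wt omega w n m)%:R <= (lam + delta) * m%:R + (N2 * B)%:R.
  case: (leqP N2 m) => h.
    have := hN2 n m h; rewrite ler_norml => /andP[_ h2].
    have : 0 <= (N2 * B)%:R :> R by [].
    lra.
  have : (wt omega w n m)%:R <= (N2 * B)%:R :> R.
    rewrite ler_nat; apply: leq_trans (wt_le w n m hB) _.
    by rewrite leq_mul2r (ltnW h) orbT.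
  have : 0 <= (lam + delta) * m%:R by rewrite mulr_ge0 //; lra.
  lra.
apply: le_trans hm2 _; rewrite lerD2r.
have ld : 0 <= lam + delta by lra.
apply: le_trans (ler_wpM2l ld hm) _.
have re : 0 <= r - 1 + eps by lra.
apply: le_trans (ler_wpM2l re hq2).
rewrite !mulrA ler_wpM2r //.
have -> : (lam + delta) * (r - 1 + eps / 2) =
   lam * (r - 1) + lam * eps / 2 + delta * (r - 1 + eps / 2) by ring.
have -> : (r - 1 + eps) * (lam - delta) =
   lam * (r - 1) + lam * eps - delta * (r - 1 + eps) by ring.
rewrite -deltaE; lra.
Qed.

Lemma wt_count n k :
  wt omega w n k = (\sum_c omega c * count_mem c (segment w n k))%N.
Proof.
have -> : wt omega w n k = (\sum_(x <- segment w n k) omega x)%N.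
  by rewrite /wt /segment big_map /index_iota subn0.
elim: (segment w n k) => [|x s IH].
  by rewrite big_nil big1 // => c _; rewrite muln0.
rewrite big_cons IH /=; under [RHS]eq_bigr do rewrite mulnDr.
rewrite big_split /=; congr (_ + _)%N.
rewrite (bigD1 x) //= eqxx muln1 big1 ?addn0 // => c /negPf cx.
by rewrite eq_sym cx muln0.
Qed.

(** Both limits range over all factors of length at least [N], so their common value, real because
    it lies between 0 and 1, is approached uniformly in the position [n]. *)
Lemma uniform_freq_count (a : S) : uniform_freq R w ->
  exists lam : R, forall delta : R, 0 < delta -> exists N : nat,
    forall n k : nat, (N <= k)%N ->
    `|(count_mem a (segment w n k))%:R - lam * k%:R| <= delta * k%:R.
Proof.
move=> hw; have [hocc|hocc] := pselect (exists i, w i = a); last first.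
  exists 0 => delta delta0; exists 0%N => n k _; rewrite mul0r subr0.
  rewrite (_ : count_mem a _ = 0%N) ?normr0 ?mulr_ge0 // ?ltW //.
  apply/eqP; rewrite eqn0Ngt -has_count; apply/hasPn => x /mapP[i _ ->].
  by apply/eqP => e; apply: hocc; exists (n + i)%N.
have hE := hw a hocc.
have L1 : (freq_limsup R w a <= 1%:E)%E.
  apply: ge_ereal_inf; exists (ereal_sup [set (freq R a f)%:E |
     f in [set f | Defs.factor w f /\ (0 <= size f)%N]]); first by exists 0%N.
  apply: ge_ereal_sup => _ [f _ <-]; rewrite lee_fin /freq.
  have [->|f0] := posnP (size f); first by rewrite invr0 mulr0.
  by rewrite ler_pdivrMr ?ltr0n // mul1r ler_nat count_size.
have L0 : (0%:E <= freq_limsup R w a)%E.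
  rewrite -hE; apply: le_ereal_sup_tmp; exists (ereal_inf [set (freq R a f)%:E |
     f in [set f | Defs.factor w f /\ (0 <= size f)%N]]); first by exists 0%N.
  by apply: le_ereal_inf_tmp => _ [f _ <-]; rewrite lee_fin divr_ge0.
case eL : (freq_limsup R w a) L0 L1 => [lam||] // _ _.
exists lam => delta delta0.
have /ereal_inf_lt[_ [N1 _ <-] h1] : (freq_limsup R w a < (lam + delta)%:E)%E.
  by rewrite eL lte_fin ltrDl.
have /ereal_sup_gt[_ [N2 _ <-] h2] : ((lam - delta)%:E < freq_liminf R w a)%E.
  by rewrite hE eL lte_fin ltrBlDr ltrDl.
exists (N1 + N2).+1 => n k hk.
have k0 : 0 < k%:R :> R by rewrite ltr0n; lia.
have fE : freq R a (segment w n k) * k%:R = (count_mem a (segment w n k))%:R.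
  by rewrite /freq size_segment mulfVK // gt_eqF.
have f1 : freq R a (segment w n k) <= lam + delta.
  rewrite -lee_fin; apply: le_trans (ltW h1); apply: ereal_sup_ubound.
  exists (segment w n k) => //; split; first exact: factor_segment.
  by rewrite size_segment; lia.
have f2 : lam - delta <= freq R a (segment w n k).
  rewrite -lee_fin; apply: le_trans (ltW h2) _; apply: ereal_inf_lbound.
  exists (segment w n k) => //; split; first exact: factor_segment.
  by rewrite size_segment; lia.
rewrite -fE -mulrBl normrM (gtr0_norm k0) ler_pM2r // ler_norml; lra.
Qed.

Lemma uniform_freq_wt : uniform_freq R w ->
  exists lam : R, forall delta : R, 0 < delta -> exists N : nat,
    forall n k : nat, (N <= k)%N ->
    `|(wt omega w n k)%:R - lam * k%:R| <= delta * k%:R.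
Proof.
move=> hw; have /choice[lam hlam] := fun a => uniform_freq_count a hw.
exists (\sum_c (omega c)%:R * lam c) => delta delta0.
set T := (\sum_c omega c)%N.
have e0 : 0 < delta / T.+1%:R by rewrite divr_gt0 // ltr0n.
have /choice[N hN] := fun a => hlam a _ e0.
exists (\max_c N c) => n k hk.
rewrite wt_count natr_sum mulr_suml -sumrB.
apply: le_trans (ler_norm_sum _ _ _) _.
apply: (@le_trans _ _ (\sum_c (omega c)%:R * (delta / T.+1%:R * k%:R))).
  apply: ler_sum => c _; rewrite natrM -mulrA -mulrBr normrM normr_nat.
  rewrite ler_wpM2l //; apply: hN; apply: leq_trans hk; exact: leq_bigmax.
rewrite -mulr_suml -natr_sum -/T mulrA ler_wpM2r //.
rewrite mulrCA ler_piMr ?ltW // ltr_pdivrMr ?ltr0n // mul1r ltr_nat //.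
Qed.

End RatioBounds.

(** With two letters, a window missing one of them is constant: a run of period 1. A constant window
    of length [M.+2] has [M.+1] matches. *)
Lemma bounded_runs_window (S : finType) (w : nat -> S) : #|S| = 2%N ->
  bounded_runs w ->
  exists K : nat, forall n c, exists2 i, (i < K)%N & w (n + i)%N = c.
Proof.
move=> hS hw; have [M hM] := hw 1%N.
have [a [b [ab hab]]] := two_letters hS.
exists M.+2 => n c; apply: contrapT => hc.
have [d hd] : exists d, forall i, (i < M.+2)%N -> w (n + i)%N = d.
  case: (hab c) => e; [exists b|exists a] => i hi;
  by case: (hab (w (n + i)%N)) => // e'; case: hc; exists i; rewrite // e e'.
have := hM n 1%N M.+1 isT; rewrite ltnn => h; apply/notF/h => k hk.
by rewrite hd 1?ltnW // -addnA hd // add1n ltnS.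
Qed.

(** * Critical exponents of injective images *)

Lemma ACE_image_le (R : realType) (S : finType) (G : eqType) (f : S -> seq G)
    (w : nat -> S) (u : nat -> G) (r c : R) :
  #|S| = 2%N -> injective (morph f) -> is_image f w u -> exponent_bound w r ->
  1 <= c ->
  (forall omega : S -> nat, (forall x, 0 < omega x)%N ->
     weight_ratio_bound omega w (c - 1)) ->
  (ACE R u <= c%:E)%E.
Proof.
move=> hS finj fu hw c1 hc; apply/ACE_leP.
have [z [g [hg g0 gm]]] := injective_morph_marked hS finj.
have [P [PS uP]] := image_parse hg g0 fu.
have bw := exponent_bound_bounded_runs hw.
apply: (image_exponent_bound c1 (fun x => size_image_letter_le g x)).
- exact: bounded_runs_image g0 gm PS uP bw.
- exact: repetition_pullback g0 gm PS uP bw.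
- exact: hc.
Qed.

(** Renaming letters injectively is an injective morphism. *)
Lemma ACE_I_ge (R : realType) (S G : finType) (w : nat -> S) :
  (#|S| <= #|G|)%N -> (ACE R w <= ACE_I R G w)%E.
Proof.
move=> hSG; pose f c : G := enum_val (widen_ord hSG (enum_rank c)).
have finj : injective f.
  by move=> c d /enum_val_inj /(congr1 val) /= /val_inj /enum_rank_inj.
have morphE s : morph (fun c => [:: f c]) s = map f s.
  by elim: s => // c s IH; rewrite /morph /= [flatten _]IH.
apply: le_trans (ACE_map_ge R f w) _; apply: ereal_sup_ubound.
exists (f \o w) => //; exists (fun c => [:: f c]); split.
  by move=> s t; rewrite !morphE => /(inj_map finj).
by move=> n; rewrite !morphE !size_map size_iota -map_comp.
Qed.

Theorem theorem30 (R : realType) (Sigma Gamma : finType)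
  (hSigma : #|Sigma| = 2%N) (hGamma : (2 <= #|Gamma|)%N)
  (w : nat -> Sigma) (r : R) (hr : ACE R w = r%:E) :
  ((uniform_freq R w \/ exists n : nat, r = n%:R) ->
     ACE_I R Gamma w = r%:E) /\
  (~ (uniform_freq R w \/ exists n : nat, r = n%:R) ->
     (ACE_I R Gamma w < ((Num.ceil r)%:~R : R)%:E)%E).
Proof.
have hw : exponent_bound w r by apply/ACE_leP; rewrite hr.
have r1 := exponent_bound_ge1 hw.
have ub (c : R) : 1 <= c ->
    (forall omega : Sigma -> nat, (forall x, 0 < omega x)%N ->
       weight_ratio_bound omega w (c - 1)) ->
    (ACE_I R Gamma w <= c%:E)%E.
  move=> c1 hc; apply: ge_ereal_sup => _ [u [f [finj fu]] <-].
  exact: ACE_image_le finj fu hw c1 hc.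
split=> [hyp|hyp].
  apply/eqP; rewrite eq_le -{2}hr ACE_I_ge ?hSigma // andbT.
  apply: ub => // omega omega0; case: hyp => [unif|[[|k] rk]].
  - have [lam hlam] := uniform_freq_wt omega unif.
    exact: weight_ratio_bound_uniform hw hlam.
  - by move: r1; rewrite rk ler10.
  - subst r; rewrite -natr1 addrK; exact: weight_ratio_bound_integer.
have [K hK] :=
  bounded_runs_window hSigma (exponent_bound_bounded_runs hw).
have r0 : 0 <= r by lra.
have /andP[tr rt] := truncn_itv r0.
case: (Num.truncn r) tr rt => [|k] kr rk; first by rewrite ltNge r1 in rk.
(* [rho] depends only on [w], so one bound [k.+1%:R + rho / (1 + rho)], strictly below [k.+2%:R],
   serves all morphisms and survives the supremum. *)
pose rho : R := 2 * K%:R / ((k.+2%:R - r) / 2).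
have rho0 : 0 <= rho by rewrite /rho divr_ge0 ?mulr_ge0 //; lra.
have theta0 : 0 <= rho / (1 + rho) by rewrite divr_ge0 //; lra.
have theta1 : rho / (1 + rho) < 1 by rewrite ltr_pdivrMr; lra.
have k1 : k.+1%:R = k%:R + 1 :> R by rewrite -natr1.
have k2 : k.+2%:R = k%:R + 2 :> R by rewrite -addn2 natrD.
have k0 : 0 <= k%:R :> R by [].
apply: le_lt_trans (ub (k.+1%:R + rho / (1 + rho)) _ _) _.
- lra.
- move=> omega omega0.
  rewrite (_ : _ - 1 = k%:R + rho / (1 + rho)); last by rewrite k1; lra.
  exact: weight_ratio_bound_noninteger.
rewrite lte_fin; apply: (@lt_le_trans _ _ k.+2%:R); first lra.
(* Since [r] is not an integer, its ceiling is at least [k.+2]. *)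
have kr' : k.+1%:R < r.
  rewrite lt_neqAle kr andbT; apply/eqP => e; apply: hyp; right.
  by exists k.+1.
have := lt_le_trans kr' (ceil_ge r); rewrite -[k.+1%:R]/(k.+1%:Z%:~R) ltr_int.
by rewrite -lezD1 -PoszD addn1 -(ler_int R).
Qed.
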